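(* Let $(A_r)_{r\ge 0}$ be a sequence of diagram algebras over an integral domain $R$ with field of fractions $\mathbb{F}$ (see context). Let $0\le s<r$, $\nu\in\widehat A_r$ and $\mathsf t\in\mathrm{Std}_r(\nu)$. Let $x\in A_r\cap A_s'$, i.e. $x\in A_r$ commutes with every element of $A_s$. Then there exist coefficients $r_{\mathsf w}\in R$ such that $$u_{\mathsf t}^*x\equiv\sum_{\substack{\mathsf w\in\mathrm{Std}_r(\nu)\\ \mathsf w_{[0,s]}\trianglerighteq\mathsf t_{[0,s]}}}r_{\mathsf w}u_{\mathsf w}^*\pmod{A_r^{\triangleright\nu}}.$$
   Context: **Cellular algebras.** A cellular algebra over $R$ is a unital $R$-algebra $A$ with an algebra involution $*$ ($R$-linear anti-automorphism, $(x^* )^*=x$), a finite poset $(\widehat A,\trianglerighteq)$, a finite index set $T(\lambda)$ for each $\lambda\in\widehat A$, and an $R$-basis $\{c^\lambda_{st}:\lambda\in\widehat A,\ s,t\in T(\lambda)\}$ such that, with $A^{\triangleright\lambda}$ (resp. $A^{\trianglerighteq\lambda}$) the span of the $c^\mu_{st}$ with $\mu\triangleright\lambda$ (resp. $\mu\trianglerighteq\lambda$): (a) for $t\in T(\lambda)$, $a\in A$ there are $r(a;t,v)\in R$ with $c^\lambda_{st}a\equiv\sum_v r(a;t,v)c^\lambda_{sv}$ mod $A^{\triangleright\lambda}$ for all $s$; (b) $(c^\lambda_{st})^*\equiv c^\lambda_{ts}$ mod $A^{\triangleright\lambda}$. The cell module $\Delta(\lambda)$ is the right $A$-module, free over $R$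 on $\{c^\lambda_t\}$, with $c^\lambda_t a=\sum_v r(a;t,v)c^\lambda_v$. There is an $A$-$A$-bimodule isomorphism $\alpha_\lambda:A^{\trianglerighteq\lambda}/A^{\triangleright\lambda}\to\Delta(\lambda)^*\otimes_R\Delta(\lambda)$, $c^\lambda_{st}+A^{\triangleright\lambda}\mapsto (c^\lambda_s)^*\otimes c^\lambda_t$, where $M^*$ is the left module obtained from a right module $M$ via $*$. $A$ is cyclic cellular if every cell module is cyclic. A cell filtration of a right module is a finite filtration $0=M_0\subseteq\dots\subseteq M_p$ with $M_i/M_{i-1}\cong\Delta(\lambda^{(i)})$; it is order preserving if $\lambda^{(i)}\triangleright\lambda^{(i+1)}$ for all $i$. **Sequence of diagram algebras.** $(A_r)_{r\ge0}$ is an increasing sequence of cellular algebras over $R$, with unital inclusions and compatible involutions; $\widehat A_r$ is the poset of $A_r$, $\Delta_r(\lambda)$ its cell modules, $A_r^{\mathbb F}=A_r\otimes_R\mathbb F$. For each $\lambda\in\widehat A_r$ a generator $\delta_r(\lambda)$ of $\Delta_r(\lambda)$ and an element $m_\lambda\in A_r^{\trianglerighteq\lambda}$ with $\alpha_\lambda(m_\lambda+A_r^{\triangleright\lambda})=\delta_r(\lambda)^*\otimes\delta_r(\lambda)$ are fixed; $\Delta_r(\lambda)$ is identified with $(m_\lambda A_r+A_r^{\triangleright\lambda})/A_r^{\triangleright\lambda}$ via $\delta_r(\lambda)a\leftrightarrow m_\lambda a+A_r^{\triangleright\lambda}$. Axioms: (D1) $A_0=R$ ($\widehat A_0=\{\varnothing\}$,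 $\Delta_0(\varnothing)=R$, $m_\varnothing=1$); (D2) each $A_r$ is cyclic cellular; (D3) $m_\lambda=m_\lambda^*$; (D4) each $A_r^{\mathbb F}$ is split semisimple; (D5) (restriction coherence) for each $\mu\in\widehat A_{r+1}$ the restriction of $\Delta_{r+1}(\mu)$ to $A_r$ has an order preserving cell filtration; (D6) below. **Branching diagram, branching factors.** $\widehat A$ is the graded directed graph with vertex set $\widehat A_r$ at level $r$ and an edge $\lambda\to\mu$ ($\lambda\in\widehat A_{r-1}$, $\mu\in\widehat A_r$) iff $\Delta_{r-1}(\lambda)$ is a subquotient in the order preserving cell filtration of the restriction of $\Delta_r(\mu)$ to $A_{r-1}$. Fixing such a filtration $(M_j)$ with isomorphisms $M_j/M_{j-1}\cong\Delta_{r-1}(\lambda_j)$, the branching factor $d_{\lambda_j\to\mu}\in A_r$ is a chosen element with $\delta_r(\mu)d_{\lambda_j\to\mu}\in M_j$ whose class in $M_j/M_{j-1}$ corresponds to $\delta_{r-1}(\lambda_j)$. (D6): there are elements $u_{\mu\to\lambda}\in A_{r+1}$ for each edge $\mu\to\lambda$ ($\mu\in\widehat A_r,\lambda\in\widehat A_{r+1}$) with $m_\lambda d_{\mu\to\lambda}=(u_{\mu\to\lambda})^*m_\mu$. **Paths, Murphy basis.** $\mathrm{Std}_r(\nu)$ is the set of directed paths $\mathsf t=(\varnothing=\mathsf t(0)\to\mathsf t(1)\to\dots\to\mathsf t(r)=\nu)$. $\mathsf t_{[0,s]}$ is the truncation of $\mathsf t$ to levels $0,\dots,s$. For $\mathsf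 t\in\mathrm{Std}_r(\nu)$, $d_{\mathsf t}=d_{\mathsf t(r-1)\to\mathsf t(r)}\cdots d_{\mathsf t(0)\to\mathsf t(1)}$ and $u_{\mathsf t}=u_{\mathsf t(0)\to\mathsf t(1)}\cdots u_{\mathsf t(r-1)\to\mathsf t(r)}$; then $u_{\mathsf t}^*=m_\nu d_{\mathsf t}$. The Murphy basis $m^\nu_{\mathsf t}=m_\nu d_{\mathsf t}+A_r^{\triangleright\nu}=u_{\mathsf t}^*+A_r^{\triangleright\nu}$, $\mathsf t\in\mathrm{Std}_r(\nu)$, is known to be an $R$-basis of $\Delta_r(\nu)$. **Dominance order on paths.** For paths from level $0$ to level $s$, $\mathsf s\trianglerighteq\mathsf t$ iff $\mathsf s(j)\trianglerighteq\mathsf t(j)$ for all $0\le j\le s$. *)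

(* Defs.v *)
From HB Require Import structures.
From mathcomp Require Import all_boot all_order all_algebra.

Set Implicit Arguments.
Unset Strict Implicit.
Unset Printing Implicit Defensive.

Import Order.TTheory GRing.Theory.
Local Open Scope ring_scope.

Definition is_basis (R : comNzRingType) (V : lmodType R) (I : finType)
    (b : I -> V) : Prop :=
  forall a : V, exists! k : {ffun I -> R}, a = \sum_i k i *: b i.

Definition in_span (R : comNzRingType) (V : lmodType R) (I : finType)
    (b : I -> V) (P : pred I) (a : V) : Prop :=
  exists k : I -> R, a = \sum_(i | P i) k i *: b i.

Section Cellular.

Variables (disp : Order.disp_t) (R : comNzRingType) (A : algType R).

(* The order of the finite poset is written so that the "dominates" relation
   of the theory is [>=].  The coefficients [cell_coef a t v] are the
   r(a; t, v) of axiom (a); they do not depend on the row index [s], and they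
   are determined by the axiom because the [cbas] form a basis. *)
Record cellular := Cellular {
  star : A -> A;
  star_linear : linear star;
  starM : forall a b, star (a * b) = star b * star a;
  starK : involutive star;
  cell_poset : finPOrderType disp;
  cell_index : cell_poset -> finType;
  cbas : forall l : cell_poset, cell_index l -> cell_index l -> A;
  cbas_family := fun i : {l : cell_poset & (cell_index l * cell_index l)%type} =>
    cbas (tagged i).1 (tagged i).2;
  cbas_basis : is_basis cbas_family;
  strictly_above := fun l : cell_poset =>
    in_span cbas_family (fun i => (l < tag i)%O);
  cell_coef : forall l : cell_poset,
    A -> cell_index l -> cell_index l -> R;
  cell_mulr : forall (l : cell_poset) (t : cell_index l) (a : A) (s : cell_index l),
    strictly_above l (cbas s t * a - \sum_v cell_coef a t v *: cbas s v);
  cell_star : forall (l : cell_poset) (s t : cell_index l),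
    strictly_above l (star (cbas s t) - cbas t s) }.

Variable C : cellular.

Definition weakly_above (l : cell_poset C) : A -> Prop :=
  in_span (@cbas_family C) (fun i => (l <= tag i)%O).

(* The cell module: the vector [x] stands for \sum_t x t *: c_t. *)
Definition cellmod (l : cell_poset C) : lmodType R :=
  {ffun cell_index l -> R^o}.

Definition cell_act (l : cell_poset C) (x : cellmod l) (a : A) : cellmod l :=
  [ffun v => \sum_t (x : {ffun _ -> _}) t * cell_coef a t v].

Definition cell_generator (l : cell_poset C) (x : cellmod l) : Prop :=
  forall y : cellmod l, exists a : A, y = cell_act x a.

Definition cyclic_cellular : Prop :=
  forall l : cell_poset C, exists x : cellmod l, cell_generator x.

(* x^* (x) y in \Delta(l)^* (x) \Delta(l), by its coordinates on the basis
   (c_s)^* (x) c_t. *)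
Definition cell_tensor (l : cell_poset C) (x y : cellmod l) :
    {ffun cell_index l * cell_index l -> R} :=
  [ffun st => (x : {ffun _ -> _}) st.1 * (y : {ffun _ -> _}) st.2].

(* [alpha_eq l m z] : m lies in A^{>= l} and the bimodule isomorphism
   alpha_l, which is the R-linear map c_st + A^{> l} |-> (c_s)^* (x) c_t,
   sends the class of m to z. *)
Definition alpha_eq (l : cell_poset C) (m : A)
    (z : {ffun cell_index l * cell_index l -> R}) : Prop :=
  weakly_above l m /\
  strictly_above l (m - \sum_st z st *: cbas st.1 st.2).

(* A cell filtration of a right A-module with underlying R-module V and
   action [act].  The isomorphism M_{i+1} / M_i -> \Delta(l_i) is encoded as a
   surjective homomorphism M_{i+1} -> \Delta(l_i) with kernel M_i; the values
   of [filt_quo i] outside M_{i+1} are irrelevant. *)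
Record cell_filtration (V : lmodType R) (act : V -> A -> V) := CellFiltration {
  filt_len : nat;
  filt_label : 'I_filt_len -> cell_poset C;
  filt_sub : nat -> V -> Prop;
  filt_quo : forall i : 'I_filt_len, V -> cellmod (filt_label i);
  filt_sub_bot : forall x, filt_sub 0 x <-> x = 0;
  filt_sub_top : forall x, filt_sub filt_len x;
  filt_subS : forall (i : 'I_filt_len) x, filt_sub i x -> filt_sub i.+1 x;
  filt_sub_linear : forall i k x y, (i <= filt_len)%N ->
    filt_sub i x -> filt_sub i y -> filt_sub i (k *: x + y);
  filt_sub_act : forall i x a, (i <= filt_len)%N ->
    filt_sub i x -> filt_sub i (act x a);
  filt_quo_linear : forall (i : 'I_filt_len) k x y,
    filt_sub i.+1 x -> filt_sub i.+1 y ->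
    filt_quo i (k *: x + y) = k *: filt_quo i x + filt_quo i y;
  filt_quo_act : forall (i : 'I_filt_len) x a, filt_sub i.+1 x ->
    filt_quo i (act x a) = cell_act (filt_quo i x) a;
  filt_quo_surj : forall (i : 'I_filt_len) y,
    exists2 x, filt_sub i.+1 x & filt_quo i x = y;
  filt_quo_ker : forall (i : 'I_filt_len) x, filt_sub i.+1 x ->
    (filt_quo i x = 0 <-> filt_sub i x) }.

Definition order_preserving (V : lmodType R) (act : V -> A -> V)
    (M : cell_filtration act) : Prop :=
  forall i j : 'I_(filt_len M), j = i.+1 :> nat ->
    (filt_label j < filt_label i)%O.

End Cellular.

(* B is A (x)_R F for F the field of fractions of R, via [phi] = (_ (x) 1):
   a multiplicative map with the universal property of extension of scalars. *)
Definition is_fraction_extension (R : idomainType) (A : algType R)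
    (B : algType {fraction R})
    (phi : {lrmorphism A -> B | @tofrac R \; *:%R}) : Prop :=
  forall (V : lmodType {fraction R}) (f : {linear A -> V | @tofrac R \; *:%R}),
    (exists g : {linear B -> V}, forall a, g (phi a) = f a) /\
    (forall g g' : {linear B -> V},
       (forall a, g (phi a) = g' (phi a)) -> g =1 g').

(* B is isomorphic, through the product of the maps [rho i], to a finite direct
   product of full matrix algebras over F. *)
Definition split_semisimple (F : fieldType) (B : algType F) : Prop :=
  exists (k : nat) (n : 'I_k -> nat)
         (rho : forall i : 'I_k, {lrmorphism B -> 'M[F]_((n i).+1)}),
    forall M : (forall i : 'I_k, 'M[F]_((n i).+1)),
      exists! b : B, forall i : 'I_k, rho i b = M i.

Definition generically_split_semisimple (R : idomainType) (A : algType R) :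
    Prop :=
  exists (B : algType {fraction R})
         (phi : {lrmorphism A -> B | @tofrac R \; *:%R}),
    is_fraction_extension phi /\ split_semisimple B.

(* The increasing sequence is given by injective unital algebra morphisms
   [incl r : A_r -> A_{r+1}].  The values of [bfac l mu] and [ufac l mu] matter
   only when l -> mu is an edge; the labels of an order preserving filtration
   are pairwise distinct, so indexing by l rather than by the position of the
   subquotient is harmless. *)
Record diagram_algebras (disp : Order.disp_t) (R : idomainType) :=
    DiagramAlgebras {
  alg : nat -> algType R;
  incl : forall r, {lrmorphism alg r -> alg r.+1};
  incl_inj : forall r, injective (incl r);
  cell : forall r, cellular disp (alg r);
  incl_star : forall r (a : alg r),
    incl r (star (cell r) a) = star (cell r.+1) (incl r a);
  Ahat := fun r => cell_poset (cell r);
  gen : forall r (l : Ahat r), cellmod l;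
  mel : forall r, Ahat r -> alg r;
  gen_generates : forall r (l : Ahat r), cell_generator (gen l);
  mel_alpha : forall r (l : Ahat r),
    alpha_eq (mel l) (cell_tensor (gen l) (gen l));
  alg0_scalar : bijective (fun k : R => k%:A : alg 0);
  Ahat_root : Ahat 0;
  Ahat0 : forall l : Ahat 0, l = Ahat_root;
  cellmod0 : #|cell_index Ahat_root| = 1%N;
  mel0 : mel Ahat_root = 1;
  alg_cyclic : forall r, cyclic_cellular (cell r);
  mel_star : forall r (l : Ahat r), star (cell r) (mel l) = mel l;
  alg_split : forall r, generically_split_semisimple (alg r);
  res_filt : forall r (mu : Ahat r.+1),
    cell_filtration (cell r)
      (fun (x : cellmod mu) (a : alg r) => cell_act x (incl r a));
  res_filt_order : forall r (mu : Ahat r.+1), order_preserving (res_filt mu);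
  edge := fun r (l : Ahat r) (mu : Ahat r.+1) =>
    [exists i : 'I_(filt_len (res_filt mu)), filt_label i == l];
  bfac : forall r, Ahat r -> Ahat r.+1 -> alg r.+1;
  bfac_sub : forall r (mu : Ahat r.+1) (i : 'I_(filt_len (res_filt mu))),
    filt_sub (res_filt mu) i.+1
      (cell_act (gen mu) (bfac (filt_label i) mu));
  bfac_quo : forall r (mu : Ahat r.+1) (i : 'I_(filt_len (res_filt mu))),
    filt_quo i (cell_act (gen mu) (bfac (filt_label i) mu)) =
      gen (filt_label i);
  ufac : forall r, Ahat r -> Ahat r.+1 -> alg r.+1;
  mel_bfac : forall r (mu : Ahat r) (l : Ahat r.+1), edge mu l ->
    mel l * bfac mu l = star (cell r.+1) (ufac mu l) * incl r (mel mu) }.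

Section Paths.

Variables (disp : Order.disp_t) (R : idomainType).
Variable D : diagram_algebras disp R.

(* The image of A_s in A_r, for s <= r. *)
Inductive from_level (s : nat) : forall r, alg D r -> Prop :=
| FromLevelBase (a : alg D s) : from_level s a
| FromLevelStep r (a : alg D r) : from_level s a -> from_level s (incl D r a).

Definition vertex_seq (r : nat) := {dffun forall j : 'I_r.+1, Ahat D j}.

Definition vertex (r : nat) (t : vertex_seq r) (j : nat) (le_jr : (j <= r)%N) :
    Ahat D j :=
  t (Ordinal (le_jr : (j < r.+1)%N)).

Definition truncate (r s : nat) (le_sr : (s <= r)%N) (t : vertex_seq r) :
    vertex_seq s :=
  [ffun j : 'I_s.+1 => vertex t (leq_trans (ltn_ord j : (j <= s)%N) le_sr)].

Definition Std (r : nat) (nu : Ahat D r) : {set vertex_seq r} :=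
  [set t : vertex_seq r |
    [&& vertex t (leq0n r) == Ahat_root D,
        [forall j : 'I_r, edge (vertex t (ltnW (ltn_ord j)))
                               (vertex t (ltn_ord j))]
      & vertex t (leqnn r) == nu]].

Fixpoint upath (r : nat) : vertex_seq r -> alg D r :=
  match r with
  | 0 => fun _ => 1
  | r'.+1 => fun t =>
      incl D r' (upath (truncate (leqnSn r') t)) *
      ufac (vertex t (leqnSn r')) (vertex t (leqnn r'.+1))
  end.

Definition path_dominates (s : nat) (p q : vertex_seq s) : bool :=
  [forall j : 'I_s.+1, (q j <= p j)%O].

End Paths.

(* Main.v *)
Require Import Defs.
From HB Require Import structures.
From mathcomp Require Import all_boot all_order all_algebra.

Set Implicit Arguments.
Unset Strict Implicit.
Unset Printing Implicit Defensive.

Import Order.TTheory GRing.Theory.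
Local Open Scope ring_scope.

(** The proof looks for an intrinsic description, in terms of the algebras
    A_j alone, of the span of the Murphy vectors whose path dominates the given
    one up to level s; anything commuting with A_s then preserves that span.

    For an upward closed set U of weights of A_j let J be the span of the
    cellular basis elements with weight in U.  It is a two-sided ideal, and over
    the field of fractions, where A_j is semisimple, it has a unit.  Clearing
    denominators gives e in J and k <> 0 in R with [a * e = k *: a] for all a in
    J ([cell_ideal_unit]).  Semisimplicity enters through von Neumann regularity:
    every a satisfies [a * y * a = k *: a] for some y and k <> 0
    ([generically_regular]).

    Fix such a set U_j at every level j, and say that a vector of a cell module
    of A_r is fixed at all levels if each e coming from a level j <= r
    multiplies it by the corresponding k.  The heart of the proof is that the
    vectors fixed at all levels are exactly the span of the Murphy vectors of
    the paths w with w(j) in U_j for all j.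

    - Such Murphy vectors are fixed.  Indeed u_w is a product in which the
      factors up to level j form u of the truncation of w, and the star of the
      latter is m_(w(j)) times something, hence lies in the ideal of U_j
      ([star_upath_level_unit]).

    - Conversely, let v be fixed in the cell module of nu
      ([level_fixed_path_span]).  If nu is not in U_r, the ideal of U_r kills
      the cell module, so k v = 0 and v = 0.  Otherwise run down the cell
      filtration of the restriction to A_(r-1): the image of v in the top layer
      is fixed, so by induction on r it is a combination of Murphy vectors of
      admissible paths ending at that layer; their extensions to nu lift them,
      and subtracting the lift leaves a fixed vector one step lower.

    For the theorem take U_j to be the weights above t(j) when j <= s, and all
    weights when j > s, so that the admissible paths are those that dominate t up
    to level s.  The elements e then either come from A_s or are
    scalars ([level_unit_above]), so they commute with x; as they fix the Murphy
    vector of t, they fix its product by x.  Working with m_nu a instead of the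
    vector gen a loses nothing because m_nu a lies strictly above nu
    exactly when gen a = 0 ([mel_strictly_above]). *)

(** * Spans and coordinates *)

Section Span.

Variables (R : comNzRingType) (V : lmodType R) (I : finType).
Variables (b : I -> V) (P : pred I).

Lemma in_span0 : in_span b P 0.
Proof. by exists (fun=> 0); rewrite big1 // => i _; rewrite scale0r. Qed.

Lemma in_spanD x y : in_span b P x -> in_span b P y -> in_span b P (x + y).
Proof.
move=> [k ->] [h ->]; exists (fun i => k i + h i); rewrite -big_split /=.
by apply: eq_bigr => i _; rewrite scalerDl.
Qed.

Lemma in_spanZ c x : in_span b P x -> in_span b P (c *: x).
Proof.
move=> [k ->]; exists (fun i => c * k i); rewrite scaler_sumr.
by apply: eq_bigr => i _; rewrite scalerA.
Qed.

Lemma in_spanB x y : in_span b P x -> in_span b P y -> in_span b P (x - y).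
Proof.
by move=> hx hy; apply: in_spanD => //; rewrite -scaleN1r; apply: in_spanZ.
Qed.

Lemma in_span_sum (J : finType) (Q : pred J) (F : J -> V) :
  (forall j, Q j -> in_span b P (F j)) -> in_span b P (\sum_(j | Q j) F j).
Proof.
by move=> hF; elim/big_ind: _ => //; [apply: in_span0 | apply: in_spanD].
Qed.

Lemma in_span_gen i : P i -> in_span b P (b i).
Proof.
move=> Pi; exists (fun j => (j == i)%:R); rewrite (bigD1 i) //= eqxx scale1r.
by rewrite big1 ?addr0 // => j /andP[_ /negPf->]; rewrite scale0r.
Qed.

End Span.

Section Coordinates.

Variables (R : comNzRingType) (V : lmodType R) (I : finType) (b : I -> V).
Hypothesis b_basis : is_basis b.

Fact coord_exists (a : V) : exists k : {ffun I -> R^o}, a == \sum_i k i *: b i.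
Proof. by have [k [ak _]] := b_basis a; exists k; apply/eqP. Qed.

Definition coord (a : V) : {ffun I -> R^o} := xchoose (coord_exists a).

Lemma coordK a : \sum_i coord a i *: b i = a.
Proof. by rewrite -(eqP (xchooseP (coord_exists a))). Qed.

Lemma coord_unique (k : {ffun I -> R^o}) a :
  a = \sum_i k i *: b i -> coord a = k.
Proof.
have [h [_ uh]] := b_basis a => ak.
by rewrite -(uh k ak); apply/esym/uh; rewrite coordK.
Qed.

Fact coord_is_linear : linear coord.
Proof.
move=> k x y; apply: coord_unique.
rewrite -[in LHS](coordK x) -[in LHS](coordK y).
rewrite scaler_sumr -big_split; apply: eq_bigr => i _ /=.
by rewrite !ffunE scalerDl scalerA.
Qed.

HB.instance Definition _ :=
  GRing.isLinear.Build R V {ffun I -> R^o} *:%R coord coord_is_linear.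

Lemma coord_basis i j : coord (b i) j = (j == i)%:R.
Proof.
have -> : coord (b i) = [ffun j => (j == i)%:R].
  apply: coord_unique; rewrite (bigD1 i) //= ffunE eqxx scale1r.
  by rewrite big1 ?addr0 // => l /negPf nli; rewrite ffunE nli scale0r.
by rewrite ffunE.
Qed.

Lemma in_span_coordP (P : pred I) a :
  in_span b P a <-> (forall i, ~~ P i -> coord a i = 0).
Proof.
split=> [[k ->] i nPi | a0]; last first.
  exists (coord a); rewrite -[LHS]coordK [RHS]big_mkcond; apply: eq_bigr => i _.
  by case: ifPn => // /a0->; rewrite scale0r.
rewrite linear_sum sum_ffunE big1 // => j Pj; rewrite linearZ ffunE coord_basis.
by case: eqP nPi => [-> | _]; rewrite ?Pj ?scaler0.
Qed.

End Coordinates.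

(** * Ideals and cell modules of a cellular algebra *)

Section CellIdeals.

Variables (disp : Order.disp_t) (R : comNzRingType) (A : algType R).
Variable C : cellular disp A.
Implicit Types (l m : cell_poset C) (U : pred (cell_poset C)) (a : A).

HB.instance Definition _ :=
  GRing.isLinear.Build R A A *:%R (star C) (star_linear C).

Definition upset U := forall l m, (l <= m)%O -> U l -> U m.

Definition cell_ideal U (a : A) :=
  in_span (@cbas_family _ _ _ C) (fun i => U (tag i)) a.

Lemma upset_ge l : upset (>= l)%O.
Proof. by move=> m n lmn; rewrite /= => /le_trans; apply. Qed.

Lemma upset_gt l : upset (> l)%O.
Proof. by move=> m n lmn; rewrite /= => /lt_le_trans; apply. Qed.

Lemma cell_idealW U U' a :
  (forall l, U l -> U' l) -> cell_ideal U a -> cell_ideal U' a.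
Proof.
move=> UU' /(in_span_coordP (cbas_basis C)) a0.
by apply/(in_span_coordP (cbas_basis C)) => i nU'; apply/a0/(contra (UU' _)).
Qed.

Lemma cell_ideal_ind U (f : A -> A) : linear f ->
  (forall l s t, U l -> cell_ideal U (f (@cbas _ _ _ C l s t))) ->
  forall a, cell_ideal U a -> cell_ideal U (f a).
Proof.
move=> f_lin fU a [k ->].
pose Lf := GRing.isLinear.Build R A A *:%R f f_lin.
pose F : {linear A -> A} := HB.pack f Lf.
rewrite -[f]/(F : A -> A) linear_sum; apply: in_span_sum => -[l [s t]] Ul.
by rewrite linearZ; apply/in_spanZ/fU.
Qed.

Lemma cbas_ideal U l s t : U l -> cell_ideal U (@cbas _ _ _ C l s t).
Proof.
move=> Ul.
exact: (@in_span_gen _ _ _ (@cbas_family _ _ _ C) (fun i => U (tag i))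
  (existT _ l (s, t))).
Qed.

(** The products of a cellular basis element leave its own weight only upwards,
    so that any upward closed set of weights spans a right ideal; the involution,
    which keeps weights up to higher terms, turns it into a left ideal too. *)
Lemma cell_ideal_mulr U a b : upset U -> cell_ideal U a -> cell_ideal U (a * b).
Proof.
move=> upU; move: a; apply: (cell_ideal_ind (f := fun a => a * b)).
  by move=> k x y; rewrite mulrDl scalerAl.
move=> l s t Ul; rewrite -[_ * b](subrK (\sum_v cell_coef b t v *: cbas s v)).
apply: in_spanD.
  by apply: cell_idealW (cell_mulr t b s) => m lm; apply: upU (ltW lm) Ul.
by apply: in_span_sum => v _; apply/in_spanZ/cbas_ideal.
Qed.

Lemma cell_ideal_star U a : upset U -> cell_ideal U a -> cell_ideal U (star C a).
Proof.
move=> upU; move: a; apply: cell_ideal_ind (star_linear C) _ => l s t Ul.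
rewrite -[star C _](subrK (cbas t s)); apply: in_spanD; last exact: cbas_ideal.
by apply: cell_idealW (cell_star s t) => m lm; apply: upU (ltW lm) Ul.
Qed.

Lemma cell_ideal_mull U a b : upset U -> cell_ideal U b -> cell_ideal U (a * b).
Proof.
move=> upU Ub; rewrite -[_ * _](starK C) starM.
by apply/cell_ideal_star => //; apply/cell_ideal_mulr/cell_ideal_star.
Qed.

(** The copy of the cell module in row [s] of the cellular basis.  Modulo the
    higher terms it is a right A-submodule of A, which is how the module laws of
    [cell_act] are derived from the associativity of A. *)
Definition cell_row l (s : cell_index l) (x : cellmod l) : A :=
  \sum_t (x : {ffun _ -> _}) t *: cbas s t.

Lemma cell_row_linear l (s : cell_index l) : linear (cell_row s).
Proof.
move=> k x y; rewrite /cell_row scaler_sumr -big_split; apply: eq_bigr => t _.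
by rewrite !ffunE /= scalerDl scalerA.
Qed.

HB.instance Definition _ l (s : cell_index l) :=
  GRing.isLinear.Build R (cellmod l) A *:%R (cell_row s) (cell_row_linear s).

Definition cell_pos l (s t : cell_index l) :
    {l : cell_poset C & (cell_index l * cell_index l)%type} :=
  Tagged (fun l => (cell_index l * cell_index l)%type) (s, t).

Lemma coord_cbas l (s t s' t' : cell_index l) :
  coord (cbas_basis C) (cbas s t) (cell_pos s' t') = ((s' == s) && (t' == t))%:R.
Proof.
rewrite -[cbas s t]/(cbas_family (cell_pos s t)) coord_basis.
rewrite eq_sym (@eq_Tagged _ _ (cell_pos s t)) /= -pair_eqE /pair_eq /=.
by rewrite ![_ == s]eq_sym ![_ == t]eq_sym.
Qed.

Lemma coordB a b i : coord (cbas_basis C) (a - b) i =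
  coord (cbas_basis C) a i - coord (cbas_basis C) b i.
Proof. by rewrite linearB !ffunE. Qed.

Lemma coord_cell_row l (s t : cell_index l) (x : cellmod l) (s' : cell_index l) :
  coord (cbas_basis C) (cell_row s x) (cell_pos s' t) =
  (s' == s)%:R * (x : {ffun _ -> _}) t.
Proof.
rewrite /cell_row linear_sum sum_ffunE (bigD1 t) //= big1 ?addr0 => [|v /negPf nvt];
  rewrite linearZ ffunE coord_cbas.
  by rewrite eqxx andbT mulrC.
by rewrite [t == v]eq_sym nvt andbF scaler0.
Qed.

Lemma strictly_above_pos l a (s t : cell_index l) :
  strictly_above l a -> coord (cbas_basis C) a (cell_pos s t) = 0.
Proof. by move/(in_span_coordP (cbas_basis C)); apply; rewrite /= ltxx. Qed.

Lemma strictly_aboveP l a : weakly_above l a ->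
  strictly_above l a <->
  (forall s t : cell_index l, coord (cbas_basis C) a (cell_pos s t) = 0).
Proof.
move=> /(in_span_coordP (cbas_basis C)) al; split=> [az s t | az].
  exact: strictly_above_pos.
apply/(in_span_coordP (cbas_basis C)) => -[m [s t]] /= nlm.
have [lm | nle] := boolP (l <= m)%O; last exact: al.
move: lm; rewrite le_eqVlt (negPf nlm) orbF => /eqP lm.
by subst m; apply: az.
Qed.

Lemma cell_row_act l (s : cell_index l) (x : cellmod l) a :
  strictly_above l (cell_row s x * a - cell_row s (cell_act x a)).
Proof.
rewrite /cell_row mulr_suml.
under [X in _ - X]eq_bigr do rewrite ffunE scaler_suml.
rewrite exchange_big -sumrB; apply: in_span_sum => t _ /=.
under eq_bigr do rewrite -scalerA.
rewrite -scaler_sumr -scalerAl -scalerBr; apply/in_spanZ/cell_mulr.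
Qed.

Lemma cell_actE l (s v : cell_index l) (x : cellmod l) a :
  (cell_act x a : {ffun _ -> _}) v =
  coord (cbas_basis C) (cell_row s x * a) (cell_pos s v).
Proof.
apply/esym/eqP; rewrite -subr_eq0; apply/eqP.
have := strictly_above_pos s v (cell_row_act s x a).
by rewrite coordB coord_cell_row eqxx mul1r.
Qed.

(** Action with the arguments swapped, so that linearity in the vector is
    available to the lemmas on linear maps. *)
Definition cell_actr l a (x : cellmod l) : cellmod l := cell_act x a.

Lemma cell_actr_linear l a : linear (@cell_actr l a).
Proof.
move=> k x y; apply/ffunP => v; rewrite [RHS]ffunE [in RHS]ffunE /cell_actr !(cell_actE v).
by rewrite linearP mulrDl -scalerAl linearP !ffunE.
Qed.

Lemma cell_act_linear l (x : cellmod l) : linear (cell_act x).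
Proof.
move=> k a b; apply/ffunP => v; rewrite [RHS]ffunE [in RHS]ffunE !(cell_actE v).
by rewrite mulrDr -scalerAr linearP !ffunE.
Qed.

HB.instance Definition _ l a := GRing.isLinear.Build R (cellmod l) (cellmod l) *:%R
  (@cell_actr l a) (@cell_actr_linear l a).

HB.instance Definition _ l x := GRing.isLinear.Build R A (cellmod l) *:%R
  (@cell_act _ _ _ C l x) (@cell_act_linear l x).

Lemma cell_actM l (x : cellmod l) a b : cell_act x (a * b) = cell_act (cell_act x a) b.
Proof.
apply/ffunP => v; rewrite !(cell_actE v) mulrA; apply/eqP; rewrite -subr_eq0.
have /strictly_above_pos : strictly_above l
    ((cell_row v x * a - cell_row v (cell_act x a)) * b).
  by apply: cell_ideal_mulr (cell_row_act v x a); apply: upset_gt.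
by move=> /(_ v v); rewrite mulrBl coordB => ->.
Qed.

(** The row of weight [l] times an element of the left ideal of [U] lies in that
    ideal, so it has no coordinate at the weight [l] outside [U]. *)
Lemma cell_act_ideal0 U l (x : cellmod l) a :
  upset U -> ~~ U l -> cell_ideal U a -> cell_act x a = 0.
Proof.
move=> upU nUl Ua; apply/ffunP => v; rewrite (cell_actE v) ffunE.
have /(in_span_coordP (cbas_basis C)) := cell_ideal_mull (cell_row v x) upU Ua.
by apply.
Qed.

(** The right linearity of the isomorphism alpha_l: the class of [m * a] is
    x^* (x) (x a). *)
Lemma coord_alpha_mul l (m a : A) (x : cellmod l) (s v : cell_index l) :
  alpha_eq m (cell_tensor x x) ->
  coord (cbas_basis C) (m * a) (cell_pos s v) =
  (x : {ffun _ -> _}) s * (cell_act x a : {ffun _ -> _}) v.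
Proof.
case=> _ mx; apply/eqP; rewrite -subr_eq0; apply/eqP.
have mE : \sum_st cell_tensor x x st *: cbas st.1 st.2 =
    \sum_s (x : {ffun _ -> _}) s *: cell_row s x.
  rewrite (eq_bigr (fun st => (x : {ffun _ -> _}) st.1 *:
      ((x : {ffun _ -> _}) st.2 *: cbas st.1 st.2))).
    rewrite -(pair_bigA _ (fun s t => (x : {ffun _ -> _}) s *:
        ((x : {ffun _ -> _}) t *: cbas s t))) /=.
    by apply: eq_bigr => t _; rewrite scaler_sumr.
  by move=> [t w] _; rewrite ffunE scalerA.
have : strictly_above l
    (m * a - \sum_s (x : {ffun _ -> _}) s *: cell_row s (cell_act x a)).
  rewrite -[m * a](subrK ((\sum_st cell_tensor x x st *: cbas st.1 st.2) * a)).
  rewrite -mulrBl -addrA.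
  apply: in_spanD; first by apply: cell_ideal_mulr mx; apply: upset_gt.
  rewrite mE mulr_suml -sumrB; apply: in_span_sum => t _.
  by rewrite -scalerAl -scalerBr; apply/in_spanZ/cell_row_act.
move=> /(strictly_above_pos s v); rewrite coordB linear_sum sum_ffunE (bigD1 s) //= big1.
  by rewrite linearZ ffunE coord_cell_row eqxx mul1r addr0.
by move=> t /negPf nts; rewrite linearZ ffunE coord_cell_row eq_sym nts mul0r scaler0.
Qed.

End CellIdeals.

(** * Scaled units from generic semisimplicity *)

Section Regularity.

Variables (R : idomainType).

Lemma fraction_denom (x : {fraction R}) :
  exists2 d : R, d != 0 & exists n : R, tofrac d * x = tofrac n.
Proof.
elim/quotW: x => x; rewrite -[x]Ratio_numden.
set n := (frac x).1; set d := (frac x).2; have d0 : d != 0 by apply: denom_ratioP.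
exists d => //; exists n.
rewrite -[_ * _]/(FracField.mul (tofrac d) _).
rewrite !piE; apply/eqmodP; rewrite /= FracField.equivfE /FracField.mulf.
by rewrite !numden_Ratio ?(oner_neq0, mulf_neq0) // mul1r mulr1.
Qed.

Lemma common_denom (I : finType) (z : I -> {fraction R}) :
  exists2 k : R, k != 0 & exists n : I -> R, forall i, tofrac k * z i = tofrac (n i).
Proof.
have [d d0 hd] : exists2 d : I -> R, (forall i, d i != 0) &
    forall i, exists n, tofrac (d i) * z i = tofrac n.
  have /fin_all_exists[d hd] i : exists d, d != 0 /\ exists n, tofrac d * z i = tofrac n.
    by have [d] := fraction_denom (z i); exists d.
  by exists d => i; have [] := hd i.
have {hd}[n hn] := fin_all_exists hd.
exists (\prod_i d i); first by apply/prodf_neq0.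
exists (fun i => (\prod_(j | j != i) d j) * n i) => i.
by rewrite (bigD1 i) //= !rmorphM /= -hn mulrCA mulrA.
Qed.

Variables (A : algType R) (I : finType) (b : I -> A).
Hypothesis b_basis : is_basis b.
Variables (B : algType {fraction R}).
Variable phi : {lrmorphism A -> B | @tofrac R \; *:%R}.
Hypothesis phi_ext : is_fraction_extension phi.

(** Coordinates seen in the field of fractions.  The universal property extends
    this map to B; since A is free, the extension recovers both the injectivity
    of A -> B and the fact that B is spanned by the image of A. *)
Definition frac_coord (a : A) : {ffun I -> {fraction R}^o} :=
  [ffun i => @tofrac R (coord b_basis a i)].

Fact frac_coord_is_linear : linear_for (@tofrac R \; *:%R) frac_coord.
Proof.
move=> k x y; apply/ffunP => i.
by rewrite !ffunE linearP !ffunE /= rmorphD rmorphM.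
Qed.

HB.instance Definition _ := GRing.isLinear.Build R A {ffun I -> {fraction R}^o}
  (@tofrac R \; *:%R) frac_coord frac_coord_is_linear.

Lemma frac_ext_inj : injective phi.
Proof.
have [[g gphi] _] := phi_ext frac_coord.
move=> x y /(congr1 g); rewrite !gphi => /ffunP xy.
rewrite -(coordK b_basis x) -(coordK b_basis y); apply: eq_bigr => i _.
by have := xy i; rewrite !ffunE => /eqP; rewrite tofrac_eq => /eqP->.
Qed.

Lemma frac_ext_denom (z : B) :
  exists2 k : R, k != 0 & exists a : A, tofrac k *: z = phi a.
Proof.
have [[g gphi] _] := phi_ext frac_coord.
(* The map sending z to this sum and the identity agree on the image of A. *)
have zE : \sum_i g z i *: phi (b i) = z.
  pose h (z : B) := \sum_i g z i *: phi (b i).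
  have h_lin : linear h.
    move=> k x y; rewrite /h scaler_sumr -big_split; apply: eq_bigr => i _ /=.
    by rewrite linearP !ffunE scalerDl scalerA.
  pose H : {linear B -> B} := HB.pack h (GRing.isLinear.Build _ B B *:%R h h_lin).
  have [_ uniq] := phi_ext phi.
  apply: (uniq H idfun) => a.
  rewrite -{2}(coordK b_basis a) linear_sum; apply: eq_bigr => i _.
  by rewrite gphi ffunE linearZ.
have [k k0 [n kn]] := common_denom (g z).
exists k => //; exists (\sum_i n i *: b i).
rewrite -{1}zE scaler_sumr linear_sum; apply: eq_bigr => i _.
by rewrite scalerA kn linearZ.
Qed.

End Regularity.

(** In each matrix block a pseudo-inverse of z does the job. *)
Lemma split_semisimple_regular (F : fieldType) (B : algType F) (z : B) :
  split_semisimple B -> exists y, z * y * z = z.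
Proof.
case=> k [n [rho rho_bij]].
have [y [yE _]] := rho_bij (fun i => pinvmx (rho i z)).
exists y; have [w [wE w_uniq]] := rho_bij (fun i => rho i z).
rewrite -[LHS]w_uniq; first exact: w_uniq.
by move=> i; rewrite !rmorphM /= yE; apply: mulmxKpV.
Qed.

Lemma generically_regular (R : idomainType) (A : algType R) (I : finType)
    (b : I -> A) : is_basis b -> generically_split_semisimple A ->
  forall a : A, exists (k : R) (y : A), k != 0 /\ a * y * a = k *: a.
Proof.
move=> b_basis [B [phi [phi_ext B_ss]]] a.
have [z az] := split_semisimple_regular (phi a) B_ss.
have [k k0 [y zy]] := frac_ext_denom b_basis phi_ext z.
exists k, y; split=> //; apply: (frac_ext_inj b_basis phi_ext).
by rewrite linearZ !rmorphM /= -zy -scalerAr -scalerAl az.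
Qed.

(** Built one cellular basis element at a time.  If [e] acts as [k] on the
    elements treated so far and [b] is the next one, [b * (k - e)] measures the
    defect at [b]; with [y] given by the regularity of that defect [a],
    replacing [k - e] by [(k - e) * (k' - y * a)] cancels it without spoiling
    the earlier elements, which [k - e] already kills. *)
Lemma cell_ideal_unit (disp : Order.disp_t) (R : idomainType) (A : algType R)
    (C : cellular disp A) (U : pred (cell_poset C)) :
  upset U -> generically_split_semisimple A ->
  exists (k : R) (e : A),
    [/\ k != 0, cell_ideal U e & forall a, cell_ideal U a -> a * e = k *: a].
Proof.
move=> upU A_ss.
have reg := generically_regular (cbas_basis C) A_ss.
pose I : finType := {l : cell_poset C & (cell_index l * cell_index l)%type}.
suff [k [e [k0 Ue eE]]] : exists (k : R) (e : A), [/\ k != 0, cell_ideal U e &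
   {in [seq i : I <- enum {: I} | U (tag i)],
     forall i, cbas_family i * e = k *: cbas_family i}].
  exists k, e; split=> // _ [h ->].
  rewrite mulr_suml scaler_sumr; apply: eq_bigr => i Ui.
  have Si : i \in [seq i : I <- enum {: I} | U (tag i)].
    by rewrite mem_filter Ui mem_enum.
  by rewrite -scalerAl (eE i Si) !scalerA mulrC.
elim: (enum _) => [|i s [k [e [k0 Ue eE]]]] /=.
  by exists 1, 0; split; [apply: oner_neq0 | apply: in_span0 |].
case: ifP => [Ui|_]; last by exists k, e.
(* The new unit is k * k' - f * (k' - y * a), expanded so as to lie in the ideal. *)
pose f := k%:A - e; pose a := cbas_family i * f.
have Ubi : cell_ideal U (cbas_family i).
  by case: i Ui @a => l [u v] /= Ul; apply: cbas_ideal.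
have Ua : cell_ideal U a.
  rewrite /a /f mulrBr mulr_algr; apply: in_spanB; first exact: in_spanZ.
  exact: cell_ideal_mull.
have [k' [y [k'0 ya]]] := reg a.
exists (k * k'), (f * (y * a) + k' *: e); split; first exact: mulf_neq0.
  by apply: in_spanD; [rewrite mulrA; apply: cell_ideal_mull | apply: in_spanZ].
move=> j; rewrite inE mulrDr -scalerAr => /predU1P[->|/eE je].
  rewrite mulrA -/a mulrA ya -scalerDr /a /f mulrBr mulr_algr subrK scalerA.
  by rewrite mulrC.
by rewrite mulrA /f mulrBr mulr_algr je subrr mul0r add0r scalerA mulrC.
Qed.

(** * Cell filtrations *)

Section Filtration.

Variables (disp : Order.disp_t) (R : comNzRingType) (A : algType R).
Variables (C : cellular disp A) (V : lmodType R) (act : V -> A -> V).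
Variable M : cell_filtration C act.

Lemma filt_sub0 i : (i <= filt_len M)%N -> filt_sub M i 0.
Proof.
elim: i => [_ | i IHi lti]; first exact/filt_sub_bot.
exact: (@filt_subS _ _ _ _ _ _ M (Ordinal lti)) (IHi (ltnW lti)).
Qed.

Variable i : 'I_(filt_len M).

Lemma filt_subD x y :
  filt_sub M i.+1 x -> filt_sub M i.+1 y -> filt_sub M i.+1 (x + y).
Proof. by move=> hx hy; rewrite -[x]scale1r; apply: filt_sub_linear. Qed.

Lemma filt_subZ k x : filt_sub M i.+1 x -> filt_sub M i.+1 (k *: x).
Proof.
by move=> hx; rewrite -[_ *: _]addr0; apply: filt_sub_linear => //; apply: filt_sub0.
Qed.

Lemma filt_quo0 : @filt_quo _ _ _ _ _ _ M i 0 = 0.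
Proof.
have M0 : filt_sub M i 0 by apply/filt_sub0/ltnW.
exact/(filt_quo_ker (filt_subS M0)).
Qed.

Lemma filt_quoD x y : filt_sub M i.+1 x -> filt_sub M i.+1 y ->
  filt_quo i (x + y) = filt_quo i x + filt_quo i y.
Proof.
by move=> hx hy; have := filt_quo_linear 1 hx hy; rewrite !scale1r.
Qed.

Lemma filt_quoZ k x :
  filt_sub M i.+1 x -> filt_quo i (k *: x) = k *: filt_quo i x.
Proof.
move=> hx; have := filt_quo_linear k hx (@filt_sub0 i.+1 (ltn_ord i)).
by rewrite filt_quo0 !addr0.
Qed.

End Filtration.

(** * Paths and Murphy vectors *)

Section PathTheory.

Variables (disp : Order.disp_t) (R : idomainType) (D : diagram_algebras disp R).

Lemma vertex_truncate r s (le_sr : (s <= r)%N) (t : vertex_seq D r) j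
    (le_js : (j <= s)%N) (le_jr : (j <= r)%N) :
  vertex (truncate le_sr t) le_js = vertex t le_jr.
Proof.
by rewrite {1}/vertex ffunE; congr (vertex t _); apply: bool_irrelevance.
Qed.

Lemma StdP r (nu : Ahat D r) (t : vertex_seq D r) :
  reflect [/\ vertex t (leq0n r) = Ahat_root D,
              forall j (lt_jr : (j < r)%N),
                edge (vertex t (ltnW lt_jr)) (vertex t lt_jr)
            & vertex t (leqnn r) = nu] (t \in Std nu).
Proof.
rewrite inE; apply: (iffP and3P) => [[/eqP t0 /forallP tE /eqP tnu] | [t0 tE tnu]].
  split=> // j lt_jr; have := tE (Ordinal lt_jr) => /=.
  by rewrite (bool_irrelevance (ltn_ord (Ordinal lt_jr)) lt_jr).
by split; [apply/eqP | apply/forallP | apply/eqP].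
Qed.

Lemma Std_truncate r (nu : Ahat D r.+1) (t : vertex_seq D r.+1) : t \in Std nu ->
  truncate (leqnSn r) t \in Std (vertex t (leqnSn r)) /\
  edge (vertex t (leqnSn r)) nu.
Proof.
case/StdP=> t0 tE tnu; split; last first.
  have := tE r (leqnn r.+1).
  by rewrite tnu (bool_irrelevance (ltnW (leqnn r.+1)) (leqnSn r)).
apply/StdP; split; first by rewrite (vertex_truncate _ _ _ (leq0n r.+1)).
  move=> j lt_jr; rewrite (vertex_truncate _ _ _ (ltnW (leqW lt_jr))).
  by rewrite (vertex_truncate _ _ _ (leqW lt_jr)).
exact: vertex_truncate.
Qed.

Fact extend_le r (j : 'I_r.+2) : j <> r.+1 :> nat -> (j <= r)%N.
Proof. by move=> jr; rewrite -ltnS ltn_neqAle -ltnS ltn_ord andbT; apply/eqP. Qed.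

(** The equality test on [j] is what lets [nu] be cast to the type of the weights
    of level [j]. *)
Definition extend r (w : vertex_seq D r) (nu : Ahat D r.+1) : vertex_seq D r.+1 :=
  [ffun j : 'I_r.+2 =>
     match j =P r.+1 :> nat with
     | ReflectT jr => ecast k (Ahat D k) (esym jr) nu
     | ReflectF jr => vertex w (extend_le jr)
     end].

Lemma vertex_extend r (w : vertex_seq D r) (nu : Ahat D r.+1) j
    (le_jr : (j <= r)%N) (le_jr' : (j <= r.+1)%N) :
  vertex (extend w nu) le_jr' = vertex w le_jr.
Proof.
rewrite {1}/vertex ffunE; case: eqP => [jr | jr] /=.
  by exfalso; move: le_jr; rewrite [j]jr ltnn.
by congr (vertex w _); apply: bool_irrelevance.
Qed.

Lemma vertex_extend_last r (w : vertex_seq D r) (nu : Ahat D r.+1) :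
  vertex (extend w nu) (leqnn r.+1) = nu.
Proof. by rewrite /vertex ffunE; case: eqP => //= jr; rewrite eq_axiomK. Qed.

Lemma truncate_extend r (w : vertex_seq D r) (nu : Ahat D r.+1) :
  truncate (leqnSn r) (extend w nu) = w.
Proof.
apply/ffunP => j; rewrite ffunE (vertex_extend _ _ (ltn_ord j : (j <= r)%N)).
by case: j => j lt_jr; rewrite /vertex (bool_irrelevance (ltn_ord (Ordinal lt_jr)) lt_jr).
Qed.

Lemma Std_extend r (l : Ahat D r) (nu : Ahat D r.+1) (w : vertex_seq D r) :
  w \in Std l -> edge l nu -> extend w nu \in Std nu.
Proof.
case/StdP=> w0 wE wl lnu; apply/StdP; split; last exact: vertex_extend_last.
  by rewrite (vertex_extend _ _ (leq0n r)).
move=> j le_jr; have [lt_jr | ge_jr] := ltnP j r.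
  by rewrite (vertex_extend _ _ (ltnW lt_jr)) (vertex_extend _ _ lt_jr).
have jr : j = r by apply/eqP; rewrite eqn_leq ge_jr andbT.
subst j; rewrite (vertex_extend _ _ (leqnn r)) wl.
by rewrite (bool_irrelevance le_jr (leqnn r.+1)) vertex_extend_last.
Qed.

Definition root_path : vertex_seq D 0 :=
  [ffun j : 'I_1 =>
     ecast k (Ahat D k) (esym (congr1 val (ord1 j) : j = 0%N :> nat))
       (Ahat_root D)].

(** The element d_t, for which u_t^* = m_nu d_t. *)
Fixpoint dpath (r : nat) : vertex_seq D r -> alg D r :=
  match r with
  | 0 => fun _ => 1
  | r'.+1 => fun t =>
      bfac (vertex t (leqnSn r')) (vertex t (leqnn r'.+1)) *
      incl D r' (dpath (truncate (leqnSn r') t))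
  end.

Lemma star1 r : star (cell D r) 1 = 1.
Proof.
by rewrite -[LHS]mul1r -[X in X * _](starK (cell D r)) -starM mul1r starK.
Qed.

(** The compatibility of the factors u and d, one edge at a time, moves the
    middle factor m from the bottom of the path to its end. *)
Lemma star_upath r (nu : Ahat D r) (t : vertex_seq D r) : t \in Std nu ->
  star (cell D r) (upath t) = mel nu * dpath t.
Proof.
elim: r nu t => [|r IHr] nu t t_std /=.
  by rewrite star1 (Ahat0 nu) mel0 mulr1.
have [tr_std e] := Std_truncate t_std; have [_ _ tnu] := StdP _ _ t_std.
rewrite starM -incl_star (IHr _ _ tr_std) rmorphM !mulrA tnu.
by rewrite mel_bfac.
Qed.

Lemma coord_mel r (nu : Ahat D r) a (s v : cell_index nu) :
  coord (cbas_basis (cell D r)) (mel nu * a) (cell_pos s v) =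
  (gen nu : {ffun _ -> _}) s * (cell_act (gen nu) a : {ffun _ -> _}) v.
Proof. exact: coord_alpha_mul (mel_alpha nu). Qed.

(** The class of [mel nu * a] is gen^* (x) (gen a), a pure tensor over a domain;
    it vanishes only if one factor does, and if gen is zero so is gen a. *)
Lemma mel_strictly_above r (nu : Ahat D r) a :
  strictly_above nu (mel nu * a) <-> cell_act (gen nu) a = 0.
Proof.
have [mel_ge _] := mel_alpha nu.
have ge : weakly_above nu (mel nu * a).
  by apply: cell_ideal_mulr mel_ge; apply: upset_ge.
split=> [/(strictly_aboveP ge) z | ga0]; last first.
  by apply/(strictly_aboveP ge) => s v; rewrite coord_mel ga0 ffunE mulr0.
apply/ffunP => v; rewrite [RHS]ffunE; apply/eqP.
have [s gs0 | g0] := pickP (fun s => (gen nu : {ffun _ -> R^o}) s != 0).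
  by have /eqP := z s v; rewrite coord_mel mulf_eq0 (negPf gs0).
suff -> : gen nu = 0 by rewrite -[cell_act _ _]/(cell_actr a 0) linear0 ffunE.
by apply/ffunP => s; rewrite ffunE; apply/eqP/negPn; rewrite g0.
Qed.

Lemma root_path_std (nu : Ahat D 0) : root_path \in Std nu.
Proof.
apply/StdP; split=> //; last by rewrite (Ahat0 (vertex _ _)) (Ahat0 nu).
exact: Ahat0.
Qed.

(** * Vectors fixed at all levels *)

Section Constraints.

Variable U : forall r, pred (Ahat D r).
Hypothesis U_up : forall r, upset (@U r).

Definition path_in r (t : vertex_seq D r) := [forall j : 'I_r.+1, @U j (t j)].

(** [level_unit e k] says that [e] is the image in A_r of an element of some
    level j <= r which is [k] times a right unit of the ideal of [U] at level j.
    Quantifying over all such elements avoids choosing one at each level. *)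
Inductive level_unit : forall r, alg D r -> R -> Prop :=
| LevelUnitTop r (e : alg D r) k : k != 0 -> cell_ideal (@U r) e ->
    (forall a, cell_ideal (@U r) a -> a * e = k *: a) -> level_unit e k
| LevelUnitStep r (e : alg D r) k : level_unit e k -> level_unit (incl D r e) k.

Lemma path_inP r (t : vertex_seq D r) :
  reflect (forall j (le_jr : (j <= r)%N), U (vertex t le_jr)) (path_in t).
Proof.
apply: (iffP forallP) => [tU j le_jr | tU [j lt_jr]]; first exact: tU (Ordinal _).
exact: tU j lt_jr.
Qed.

Lemma path_in_truncate r (t : vertex_seq D r.+1) :
  path_in t -> path_in (truncate (leqnSn r) t).
Proof.
move/path_inP=> tU; apply/path_inP => j le_jr.
by rewrite (vertex_truncate _ _ _ (leqW le_jr)).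
Qed.

Lemma path_in_extend r (w : vertex_seq D r) (nu : Ahat D r.+1) :
  path_in w -> U nu -> path_in (extend w nu).
Proof.
move/path_inP=> wU nuU; apply/path_inP => j le_jr.
have [le_jr' | gt_jr] := leqP j r; first by rewrite (vertex_extend _ _ le_jr').
have jr : j = r.+1 by apply/eqP; rewrite eqn_leq le_jr.
by subst j; rewrite (bool_irrelevance le_jr (leqnn r.+1)) vertex_extend_last.
Qed.

(** At the top level, the star of u_t is m_nu d_t and so lies in the ideal.  At a
    lower level, the star of the lower part of the path is the rightmost factor,
    so that it is what meets [e] first. *)
Lemma star_upath_level_unit r (e : alg D r) k : level_unit e k ->
  forall (nu : Ahat D r) (t : vertex_seq D r), t \in Std nu -> path_in t ->
  star (cell D r) (upath t) * e = k *: star (cell D r) (upath t).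
Proof.
elim=> {r e k} [r e k _ _ eE | r e k _ IHe] nu t t_std tU.
  apply: eE; rewrite (star_upath t_std); apply: cell_ideal_mulr => //.
  have [mel_ge _] := mel_alpha nu.
  apply: cell_idealW mel_ge => l le_nul; apply: U_up le_nul _.
  by have [_ _ <-] := StdP _ _ t_std; move/path_inP: tU; apply.
have [tr_std _] := Std_truncate t_std.
rewrite /= starM -mulrA -incl_star -rmorphM /=.
by rewrite (IHe _ _ tr_std (path_in_truncate tU)) linearZ -scalerAr.
Qed.

(** The Murphy vector of [w] in the cell module of [nu], for [w] ending at [nu]. *)
Definition mvec r (nu : Ahat D r) (w : vertex_seq D r) : cellmod nu :=
  cell_act (gen nu) (dpath w).

Definition level_fixed r (nu : Ahat D r) (v : cellmod nu) :=
  forall (e : alg D r) k, level_unit e k -> cell_act v e = k *: v.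

Definition path_span r (nu : Ahat D r) :=
  in_span (mvec nu) (fun w => (w \in Std nu) && path_in w).

Lemma gen_act_level_fixed r (nu : Ahat D r) a :
  (forall e k, level_unit e k -> mel nu * a * e = k *: (mel nu * a)) ->
  level_fixed (cell_act (gen nu) a).
Proof.
move=> aE e k /aE aeE; apply/eqP; rewrite -subr_eq0 -cell_actM -linearZ -linearB /=.
apply/eqP/mel_strictly_above; rewrite mulrBr mulrA aeE scalerAr subrr.
exact: in_span0.
Qed.

Lemma path_span_level_fixed r (nu : Ahat D r) (v : cellmod nu) :
  path_span v -> level_fixed v.
Proof.
move=> [c ->] e k ek; rewrite -[cell_act _ _]/(cell_actr e _) linear_sum scaler_sumr.
apply: eq_bigr => w /andP[w_std wU]; rewrite linearZ !scalerA mulrC -scalerA.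
congr (_ *: _); apply: (gen_act_level_fixed _ ek) => {}e {}k {}ek.
by rewrite -(star_upath w_std) (star_upath_level_unit ek w_std wU).
Qed.

Lemma level_unit_exists r : exists (e : alg D r) k,
  [/\ k != 0, cell_ideal (@U r) e & level_unit e k].
Proof.
have [k [e [k0 Ue eE]]] := cell_ideal_unit (@U_up r) (alg_split D r).
by exists e, k; split=> //; apply: LevelUnitTop.
Qed.

(** A scaled unit of the ideal of [U] at the top level kills the module, and also
    acts on [v] by a nonzero scalar. *)
Lemma level_fixed_eq0 r (nu : Ahat D r) (v : cellmod nu) :
  ~~ U nu -> level_fixed v -> v = 0.
Proof.
move=> nUnu vfix; have [e [k [k0 Ue ek]]] := level_unit_exists r.
have := vfix e k ek; rewrite (cell_act_ideal0 _ _ nUnu Ue) // => /esym/ffunP kv0.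
apply/ffunP => t; have /eqP := kv0 t; rewrite !ffunE.
by rewrite [_ *: _]/(k * _) mulf_eq0 (negPf k0) => /eqP.
Qed.

(** The quotient maps of the cell filtration are linear over the lower algebra,
    so they preserve fixed vectors; this allows an induction on the level, and
    inside it on the steps of the filtration. *)
Lemma level_fixed_path_span r (nu : Ahat D r) (v : cellmod nu) :
  level_fixed v -> path_span v.
Proof.
elim: r nu v => [|r IHr] nu v vfix;
  have [nuU | /level_fixed_eq0/(_ vfix)->] := boolP (U nu); try exact: in_span0.
  have [a ->] := @gen_generates _ _ D 0 nu v.
  have [g _ gK] := alg0_scalar D; rewrite -(gK a) linearZ /=.
  apply/in_spanZ; apply: (@in_span_gen _ _ _ (mvec nu) _ root_path).
  rewrite root_path_std; apply/path_inP => -[|//] le00.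
  by rewrite (Ahat0 (vertex _ _)) -(Ahat0 nu).
pose M := res_filt nu.
suff: forall i, (i <= filt_len M)%N ->
    forall v, filt_sub M i v -> level_fixed v -> path_span v.
  by move=> /(_ _ (leqnn _) v (filt_sub_top M v)); apply.
elim=> {v vfix} [_ v /filt_sub_bot-> _ | i IHi lti v vi vfix].
  exact: in_span0.
pose o := Ordinal lti; set l := filt_label (c := M) o.
have vo : filt_sub M o.+1 v := vi.
have [c qE] : path_span (filt_quo (c := M) o v).
  apply: IHr => e k /LevelUnitStep/vfix vE.
  by rewrite -(filt_quo_act _ vo) vE filt_quoZ.
(* The branching factors lift Murphy vectors of the layer to those of nu. *)
have [u [ui u_span uq]] : exists u, [/\ filt_sub M o.+1 u, path_span u
    & filt_quo (c := M) o u = filt_quo (c := M) o v].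
  rewrite qE; elim/big_ind: _ => [|x y [u [ui u_s <-]] [w [wi w_s <-]]|
    w /andP[w_std wU]].
  - by exists 0; split; [apply: filt_sub0 | apply: in_span0 | apply: filt_quo0].
  - exists (u + w); split; last exact: filt_quoD.
      exact: (@filt_subD _ _ _ _ _ _ _ o).
    exact: in_spanD.
  have lnu : edge l nu by apply/existsP; exists o.
  have wi : filt_sub M o.+1 (mvec nu (extend w nu)).
    rewrite /mvec /= truncate_extend (vertex_extend _ _ (leqnn r)).
    rewrite vertex_extend_last; have [_ _ ->] := StdP _ _ w_std.
    by rewrite cell_actM; apply: (filt_sub_act _ lti (@bfac_sub _ _ D r nu o)).
  exists (c w *: mvec nu (extend w nu)); split.
  - exact: (@filt_subZ _ _ _ _ _ _ _ o).
  - apply/in_spanZ/in_span_gen.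
    by rewrite (Std_extend w_std lnu) path_in_extend.
  rewrite filt_quoZ //; congr (_ *: _).
  rewrite /mvec /= truncate_extend (vertex_extend _ _ (leqnn r)).
  rewrite vertex_extend_last; have [_ _ ->] := StdP _ _ w_std.
  rewrite cell_actM.
  by rewrite (filt_quo_act _ (@bfac_sub _ _ D r nu o)) bfac_quo.
rewrite -(subrK u v); apply: in_spanD => //; apply: IHi; first exact: ltnW.
  have uvi : filt_sub M o.+1 (v - u).
    rewrite -scaleN1r; apply: filt_subD => //.
    exact: (@filt_subZ _ _ _ _ _ _ _ o).
  apply/(filt_quo_ker uvi).
  rewrite -scaleN1r filt_quoD ?filt_quoZ //; last first.
    exact: (@filt_subZ _ _ _ _ _ _ _ o).
  by rewrite uq scaleN1r subrr.
move=> e k ek; rewrite -[cell_act _ _]/(cell_actr e _) linearB /= /cell_actr.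
by rewrite (vfix _ _ ek) (path_span_level_fixed u_span ek) scalerBr.
Qed.

End Constraints.
End PathTheory.

(** * Dominance up to a given level *)

Lemma from_level_eq (disp : Order.disp_t) (R : idomainType)
    (D : diagram_algebras disp R) s r (e : alg D r) : s = r -> from_level s e.
Proof. by move=> sr; subst s; apply: FromLevelBase. Qed.

Section Above.

Variables (disp : Order.disp_t) (R : idomainType) (D : diagram_algebras disp R).
Variables (s : nat) (p : vertex_seq D s).

(** Void beyond the last level of [p], so that it constrains paths of any
    length. *)
Definition above j : pred (Ahat D j) := fun l =>
  if decP (@idP (j <= s)%N) is left le_js then (vertex p le_js <= l)%O else true.

Lemma aboveE j (le_js : (j <= s)%N) (l : Ahat D j) : above l = (vertex p le_js <= l)%O.
Proof.
rewrite /above; case: decP => // le_js'.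
by rewrite (bool_irrelevance le_js' le_js).
Qed.

Lemma above_gt j (l : Ahat D j) : (s < j)%N -> above l.
Proof. by rewrite /above; case: decP => // le_js; rewrite ltnNge le_js. Qed.

Lemma above_up j : upset (@above j).
Proof.
move=> l m lm; rewrite /above; case: decP => // le_js pl.
exact: le_trans pl lm.
Qed.

(** Beyond level s the ideal is the whole algebra, and multiplying 1 by a scaled
    unit shows that it is a scalar. *)
Lemma level_unit_above r (e : alg D r) k : level_unit above e k -> (s <= r)%N ->
  from_level s e \/ e = k%:A.
Proof.
elim=> {r e k} [r e k k0 _ eE | r e k _ IHe]; rewrite leq_eqVlt => /predU1P[sr | gt_rs].
- by left; apply: from_level_eq.
- right; rewrite -(eE 1) ?mul1r //.
  apply: cell_idealW (_ : cell_ideal predT 1) => [l _ | ]; first exact: above_gt.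
  exists (coord (cbas_basis (cell D r)) 1).
  by rewrite [LHS](esym (coordK (cbas_basis (cell D r)) 1)).
- by left; apply: from_level_eq.
case: (IHe gt_rs) => [es | ->]; first by left; apply: FromLevelStep.
by right; rewrite linearZ rmorph1.
Qed.

Lemma path_in_above r (le_sr : (s <= r)%N) (w : vertex_seq D r) :
  path_in above w = path_dominates (truncate le_sr w) p.
Proof.
apply/path_inP/forallP => [wU j | wp j le_jr].
  have le_js : (j <= s)%N := ltn_ord j.
  have := wU j (leq_trans le_js le_sr).
  rewrite (aboveE le_js) -(vertex_truncate le_sr _ le_js).
  by case: j le_js => j lt_js le_js; rewrite /vertex (bool_irrelevance le_js lt_js).
have [le_js | ] := leqP j s; last exact: above_gt.
rewrite (aboveE le_js) -(vertex_truncate le_sr _ le_js).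
exact: wp (Ordinal _).
Qed.

End Above.

Theorem proposition3p14 (disp : Order.disp_t) (R : idomainType)
    (D : diagram_algebras disp R) (r s : nat) (lt_sr : (s < r)%N)
    (nu : Ahat D r) (t : vertex_seq D r) (t_std : t \in Std nu)
    (x : alg D r)
    (x_comm : forall a : alg D r, from_level s a -> x * a = a * x) :
  exists c : vertex_seq D r -> R,
    strictly_above nu
      (star (cell D r) (upath t) * x -
       \sum_(w in Std nu |
             path_dominates (truncate (ltnW lt_sr) w) (truncate (ltnW lt_sr) t))
         c w *: star (cell D r) (upath w)).
Proof.
pose p := truncate (ltnW lt_sr) t.
have t_in : path_in (above p) t.
  by rewrite (path_in_above _ (ltnW lt_sr)); apply/forallP => j; apply: lexx.
have [|c cE] := @level_fixed_path_span _ _ D (above p) (@above_up _ _ _ _ p) r nu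
    (cell_act (gen nu) (dpath t * x)).
  apply: gen_act_level_fixed => e k ek; rewrite mulrA -(star_upath t_std) -mulrA.
  have -> : x * e = e * x.
    have [/x_comm // | ->] := level_unit_above ek (ltnW lt_sr).
    by rewrite mulr_algr mulr_algl.
  by rewrite mulrA (star_upath_level_unit (@above_up _ _ _ _ p) ek t_std t_in) scalerAl.
exists c.
pose y := \sum_(w in Std nu | path_dominates (truncate (ltnW lt_sr) w) p)
  c w *: dpath w.
have -> : star (cell D r) (upath t) * x -
    \sum_(w in Std nu | path_dominates (truncate (ltnW lt_sr) w) p)
      c w *: star (cell D r) (upath w) = mel nu * (dpath t * x - y).
  rewrite mulrBr mulrA -(star_upath t_std) mulr_sumr; congr (_ - _).
  apply: eq_bigr => w /andP[w_std _].
  by rewrite -scalerAr (star_upath w_std).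
apply/mel_strictly_above; rewrite linearB /= cE linear_sum.
apply/eqP; rewrite subr_eq0.
apply/eqP/eq_big => [w | w _]; first by rewrite (path_in_above _ (ltnW lt_sr)).
by rewrite linearZ.
Qed.
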